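(* Let $G=(V,E)$ be a graph with a unique perfect matching $M$, and for a vertex $v$ let $M(v)$ denote the vertex matched to $v$ by $M$. Consider the following procedure. Start with $K=\emptyset$ and $H=G$. While $H$ has a vertex $v$ of degree $1$ in $H$, replace $K$ by $K\cup\{v,M(v)\}$ and replace $H$ by $(H-v)-M(v)$. When no vertex of $H$ has degree $1$, output $(V\setminus K,\,K)$. Then the output equals $(SD(G),KE(G))$.
   Context: All graphs are finite, undirected and simple; $H-v$ denotes the graph obtained from $H$ by deleting the vertex $v$. Let $M$ be a matching of a graph $G$. A path (or walk) is $M$-alternating if, of any two consecutive edges, exactly one belongs to $M$; an $mm$-$M$-path is an $M$-alternating path whose first and last edges are in $M$. An $M$-blossom is an odd cycle of length $2k+1$ with exactly $k$ edges in $M$; its base is the unique vertex of the cycle not covered by those $k$ edges. An $M$-Tflower consists of an $M$-blossom together with an $M$-stem, i.e. an $M$-alternating path of even length (possibly zero) connecting the base of the blossom to a vertex not saturated by $M$ in $G$, where the base is the only common vertex of the blossom and the stem. An $M$-Tposy consists of two $M$-blossoms joined by an $mm$-$M$-path whose endpoints are the bases of the two blossoms, such that no internal vertex of the path lies in the blossoms and the intersection of the two blossoms is either empty or an $mm$-$M$-path. Define $SD(G)$ as the set of vertices $v$ of $G$ for which there is a maximum matching $M$ of $G$ such that $v$ lies in an $M$-Tflower or an $M$-Tposy, and $KE(G)=V(G)\setminus SD(G)$. *)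

(* Defs.v *)
From Stdlib Require Import Relation_Operators.
From mathcomp Require Import all_boot.
From mathcomp Require Import boolp.

Set Implicit Arguments.
Unset Strict Implicit.
Unset Printing Implicit Defensive.

(* A simple graph with vertex set T; finiteness comes from T : finType. *)
Record sgraph (T : finType) := SGraph {
  adj :> rel T;
  adj_sym : symmetric adj;
  adj_irrefl : irreflexive adj
}.

Section Defs.
Variables (T : finType) (G : sgraph T).
Implicit Types (M : {set {set T}}) (c p : seq T) (x b v : T).

Definition edges : {set {set T}} :=
  [set [set x; y] | x in T, y in T & adj G x y].

Definition matching M : Prop := M \subset edges /\ trivIset M.

(* cover M is the set of vertices saturated by M. *)
Definition perfect_matching M : Prop := matching M /\ cover M = [set: T].

Definition maximum_matching M : Prop :=
  matching M /\ forall M', matching M' -> #|M'| <= #|M|.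

(* M(v). The default value v is only reached when v is not saturated by M. *)
Definition mate M v : T := odflt v [pick w | [set v; w] \in M].

(* A path (no repeated vertex) is given by its first vertex x and the sequence
   p of the following ones, so size p is its length in edges. *)
Definition is_path x p : bool := path (adj G) x p && uniq (x :: p).

Definition path_edges x p : seq {set T} :=
  pairmap (fun y z => [set y; z]) x p.

(* sorted tests its relation on consecutive items only. *)
Definition alternating M x p : bool :=
  sorted (fun a b : {set T} => (a \in M) (+) (b \in M)) (path_edges x p).

Definition alt_path M x p : bool := is_path x p && alternating M x p.

(* The default value set0 is never reached, since 0 < size p. *)
Definition mm_path M x p : bool :=
  [&& alt_path M x p, 0 < size p,
      head set0 (path_edges x p) \in M & last set0 (path_edges x p) \in M].

Definition is_cycle c : bool := [&& cycle (adj G) c, uniq c & 2 < size c].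

Definition cycle_edges c : {set {set T}} := [set [set x; next c x] | x in c].

(* c is an M-blossom with base b. *)
Definition blossom M c b : Prop :=
  is_cycle c /\
  (exists k, size c = k.*2.+1 /\ #|cycle_edges c :&: M| = k) /\
  [set x in c] :\: cover (cycle_edges c :&: M) = [set b].

(* The blossom c, of base b, together with the stem b :: p. *)
Definition Tflower M c b p : Prop :=
  blossom M c b /\
  alt_path M b p /\ ~~ odd (size p) /\ last b p \notin cover M /\
  [set x in c] :&: [set x in b :: p] = [set b].

(* The intersection of two cycles, as subgraphs, is empty or an mm-M-path. *)
Definition meet_in_mm_path M c1 c2 : Prop :=
  [set x in c1] :&: [set x in c2] = set0 \/
  exists x p, mm_path M x p /\
    [set y in c1] :&: [set y in c2] = [set y in x :: p] /\
    cycle_edges c1 :&: cycle_edges c2 = [set a in path_edges x p].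

(* The blossoms c1 and c2, of bases b1 and b2, joined by the path b1 :: p. *)
Definition Tposy M c1 b1 c2 b2 p : Prop :=
  blossom M c1 b1 /\ blossom M c2 b2 /\
  mm_path M b1 p /\ last b1 p = b2 /\
  (forall x, x \in b1 :: p -> x != b1 -> x != b2 ->
     x \notin c1 /\ x \notin c2) /\
  meet_in_mm_path M c1 c2.

Definition in_Tflower M v : Prop :=
  exists c b p, Tflower M c b p /\ (v \in c \/ v \in b :: p).

Definition in_Tposy M v : Prop :=
  exists c1 b1 c2 b2 p, Tposy M c1 b1 c2 b2 p /\
    (v \in c1 \/ v \in c2 \/ v \in b1 :: p).

Definition SD : {set T} :=
  [set v | `[< exists M, maximum_matching M /\
                         (in_Tflower M v \/ in_Tposy M v) >]].

Definition KE : {set T} := ~: SD.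

(* A state of the procedure is a pair (K, H). As H is only ever modified by
   deleting vertices, it is an induced subgraph of G; it is represented by its
   vertex set. *)
Definition state : Type := ({set T} * {set T})%type.

Definition degree_in (H : {set T}) v : nat := #|[set w in H | adj G v w]|.

(* The choice of the vertex v of degree 1 is left open. *)
Inductive step M : state -> state -> Prop :=
| Step (K H : {set T}) v :
    v \in H -> degree_in H v = 1 ->
    step M (K, H) (K :|: [set v; mate M v], (H :\ v) :\ mate M v).

Definition initial_state : state := (set0, [set: T]).

Definition always_terminates M : Prop :=
  Acc (fun s' s => step M s s') initial_state.

(* out is the output of some run of the procedure. *)
Definition is_output M (out : {set T} * {set T}) : Prop :=
  exists K H : {set T},
    clos_refl_trans state (step M) initial_state (K, H) /\
    (forall v, v \in H -> degree_in H v <> 1) /\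
    out = (~: K, K).

End Defs.

(* Main.v *)
From Stdlib Require Import Relation_Operators.
Require Import Defs.
From mathcomp Require Import all_boot boolp.

(* Every maximum matching of G is M, and it saturates all vertices, so SD(G)
   consists of the vertices of the M-Tposies. This set is closed under M-mates
   and induces a subgraph of minimum degree at least 2, so the procedure never
   deletes any of it. Conversely the final H has minimum degree at least 2: in
   H, take an mm-M-path x_0, ..., x_(2k+1) through a given vertex that cannot
   be extended. Each end has a second neighbour, and it lies on the path. Since
   M is unique there is no M-alternating even cycle, so these neighbours are
   x_i with i even for x_0 and x_j with j odd for x_(2k+1), and i < j (if j < i,
   then x_0, ..., x_j, x_(2k+1), ..., x_i would be such a cycle). The path
   together with both chords is an M-Tposy. *)

(** * Perfect matchings and the mate involution *)

Section Matchings.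
Set Implicit Arguments.
Unset Strict Implicit.
Variables (T : finType) (G : sgraph T).
Implicit Types (M : {set {set T}}) (x y : T).

Lemma edgesP x y : ([set x; y] \in edges G) = adj G x y.
Proof.
apply/imset2P/idP => [[a b _ /[!inE] ab E]|xy]; last by exists x y; rewrite ?inE.
have anb : a != b by apply: contraTneq ab => ->; rewrite adj_irrefl.
have : a \in [set x; y] by rewrite E !inE eqxx.
have : b \in [set x; y] by rewrite E !inE eqxx orbT.
rewrite !inE => /orP[]/eqP eb /orP[]/eqP ea; subst; rewrite ?eqxx // in anb *.
by rewrite adj_sym.
Qed.

Lemma edges_card M : M \subset edges G -> {in M, forall E : {set T}, #|E| = 2}.
Proof.
move=> /subsetP sM E /sM /imset2P[x y _ /[!inE] xy ->].
by rewrite cards2; case: eqP xy => // ->; rewrite adj_irrefl.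
Qed.

Lemma card_cover_matching M : matching G M -> #|cover M| = #|M| * 2.
Proof.
case=> sM /eqP <-; rewrite -sum_nat_const.
by apply: eq_bigr => E /(edges_card sM).
Qed.

(** A matching covers twice as many vertices as it has edges, so comparing sizes amounts to
    comparing covers, and [M] covers everything. *)
Lemma perfect_matching_maximum M M' : perfect_matching G M ->
  maximum_matching G M' <-> perfect_matching G M'.
Proof.
move=> [mM cM]; split=> [[mM' maxM']|[mM' cM']]; last first.
  split=> // N mN; rewrite -(leq_pmul2r (isT : 0 < 2)) -!card_cover_matching //.
  by rewrite cM' cardsT max_card.
split=> //; apply/eqP; rewrite eqEcard subsetT /= -cM !card_cover_matching //.
by rewrite leq_pmul2r // maxM'.
Qed.

Section Mate.
Variable M : {set {set T}}.
Hypothesis hM : perfect_matching G M.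
Local Notation m := (mate M).

Lemma mate_edge x : [set x; m x] \in M.
Proof.
rewrite /mate; case: pickP => //= noM.
have: x \in cover M by rewrite hM.2 inE.
case/bigcupP=> E EM; have := EM; move/(subsetP hM.1.1)/imset2P=> [a b _ _ Eab].
rewrite Eab !inE => /orP[]/eqP xE; subst; first by rewrite noM in EM.
by rewrite setUC noM in EM.
Qed.

Lemma adj_mate x : adj G x (m x).
Proof. by rewrite -edgesP (subsetP hM.1.1) ?mate_edge. Qed.

Lemma mate_neq x : m x != x.
Proof. by apply/eqP => E; have := adj_mate x; rewrite E adj_irrefl. Qed.

Lemma mem_matching x y : ([set x; y] \in M) = (y == m x).
Proof.
apply/idP/eqP => [xyM|->]; last exact: mate_edge.
have: [set x; y] = [set x; m x].
  apply/eqP; apply: contraTT isT => ne.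
  have := (trivIsetP hM.1.2) _ _ xyM (mate_edge x) ne.
  by rewrite disjoint_subset => /subsetP/(_ x); rewrite !inE eqxx => /(_ isT).
move/setP/(_ y); rewrite !inE eqxx orbT => /esym/orP[]/eqP // E.
by have := subsetP hM.1.1 _ xyM; rewrite E edgesP adj_irrefl.
Qed.

Lemma mateK : involutive m.
Proof. by move=> x; apply/esym/eqP; rewrite -mem_matching setUC mate_edge. Qed.

End Mate.

Lemma involution_perfect_matching (f : T -> T) :
  involutive f -> (forall x, adj G x (f x)) ->
  perfect_matching G [set [set x; f x] | x in T].
Proof.
move=> fK fadj; split; last first.
  apply/setP => x; rewrite inE; apply/bigcupP; exists [set x; f x].
    exact: imset_f.
  by rewrite !inE eqxx.
split; first by apply/subsetP => E /imsetP[x _ ->]; rewrite edgesP.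
apply/trivIsetP => E F /imsetP[x _ ->] /imsetP[y _ ->].
apply: contraR => /pred0Pn[z /andP[]] /=.
rewrite !inE => /orP[]/eqP -> /orP[]/eqP // e; first by rewrite e.
- by rewrite e fK setUC.
- by rewrite -e fK setUC.
by rewrite (can_inj fK e).
Qed.

Definition unique_perfect_matching M : Prop :=
  perfect_matching G M /\ forall M', perfect_matching G M' -> M' = M.

(** The form in which uniqueness is used: an exchange argument only has to present the new matching
    as an involution along edges. *)
Lemma unique_mate M (f : T -> T) : unique_perfect_matching M ->
  involutive f -> (forall x, adj G x (f x)) -> f =1 mate M.
Proof.
case=> hM uM fK fadj x; apply/eqP; rewrite -(mem_matching hM).
by rewrite -(uM _ (involution_perfect_matching fK fadj)); apply/imsetP; exists x.
Qed.

End Matchings.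

(** * Alternating paths encoded as directed paths *)

Section AlternatingPaths.
Set Implicit Arguments.
Unset Strict Implicit.
Variables (T : finType) (G : sgraph T) (M : {set {set T}}).
Hypothesis hM : perfect_matching G M.
Implicit Types (a b x y : T) (u : seq T).
Local Notation m := (mate M).

Let mK : involutive m := mateK hM.

(* The arcs [a -> b] are the pairs [a, m a, b] that can follow one another in
   an alternating path, so that [mm]-paths become directed paths. *)
Definition arc a b : bool := adj G (m a) b.

(** The vertex sequence of the encoded path. Its [uniq] is stronger than that of [u]: it also
    forbids [u] to contain both ends of a matching edge. *)
Definition unfold_arcs u : seq T := flatten [seq [:: a; m a] | a <- u].
Local Notation dbl := unfold_arcs.

(** Reversing an alternating path reverses the arcs and replaces each entry by its mate. *)
Lemma arc_mate a b : arc (m b) (m a) = arc a b.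
Proof. by rewrite /arc mK adj_sym. Qed.

Lemma dbl_cat u1 u2 : dbl (u1 ++ u2) = dbl u1 ++ dbl u2.
Proof. by rewrite /dbl map_cat flatten_cat. Qed.

Lemma mem_dbl u x : (x \in dbl u) = (x \in u) || (m x \in u).
Proof.
elim: u => //= a u IH; rewrite !inE IH (can2_eq mK mK).
by rewrite -!orbA; do !bool_congr; rewrite orbCA.
Qed.

Lemma size_dbl u : size (dbl u) = (size u).*2.
Proof. by elim: u => //= a u ->. Qed.

Lemma uniq_dblP u : uniq (dbl u) -> uniq u /\ {in u, forall x, m x \notin u}.
Proof.
elim: u => //= a u IH /and3P[]; rewrite inE !mem_dbl mK !negb_or.
move=> /and3P[_ aN maN] /andP[_ _] /IH[uu mu]; rewrite aN; split=> // x.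
rewrite !inE negb_or => /predU1P[->|xu]; first by rewrite (mate_neq hM).
by rewrite mu // andbT; apply: contraNneq maN => <-; rewrite mK.
Qed.

Lemma path_dbl a u : path arc a u -> path (adj G) (m a) (dbl u).
Proof. by elim: u a => //= b u IH a /andP[ab /IH ->]; rewrite -/(arc a b) ab (adj_mate hM). Qed.

Lemma last_dbl a u : last (m a) (dbl u) = m (last a u).
Proof. by elim: u a => //= b u IH a. Qed.

Lemma mm_path_dbl a u : path arc a u -> uniq (dbl (a :: u)) ->
  mm_path G M a (m a :: dbl u).
Proof.
move=> pu uu; rewrite /mm_path /alt_path /is_path uu /= (adj_mate hM).
rewrite path_dbl // (mem_matching hM) // eqxx /= /alternating /=.
set e := [set a; m a]; apply/andP; split; last first.
  rewrite {}/e {uu}; elim: u a pu => [|b u IH] a /=; first by rewrite (mem_matching hM).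
  by move=> /andP[_ /IH].
rewrite {}/e; elim: u a pu uu => [|b u IH] a //= /andP[_ pu] /and3P[aN _ uu].
rewrite !(mem_matching hM) !eqxx mK /= IH // andbT.
by rewrite addbT andbb; apply: contraNneq aN => ->; rewrite !inE eqxx orbT.
Qed.

Lemma next_dbl b u a : uniq (b :: dbl u) -> a \in u -> next (b :: dbl u) a = m a.
Proof.
move=> uu au; have adu : a \in dbl u by rewrite mem_dbl au.
rewrite next_nth inE adu orbT; case/splitPr: au uu {adu} => u1 u2.
rewrite dbl_cat /= mem_cat negb_or inE negb_or cat_uniq /= negb_or.
move=> /and3P[/and3P[_ ba _] _ /and3P[/andP[aN _] _ _]].
rewrite (negPf ba) index_cat (negPf aN) /= eqxx addn0.
by rewrite nth_cat ltnNge leqnSn /= subSnn.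
Qed.

(** Each entry of [a :: u] contributes one matching edge to the cycle. As the mate of [b] is off the
    cycle, both cycle edges at [b] are unmatched, which makes [b] the base. *)
Lemma blossom_dbl b a u : uniq (b :: dbl (a :: u)) ->
  m b \notin dbl (a :: u) -> path arc a u ->
  adj G b a -> adj G b (m (last a u)) -> blossom G M (b :: dbl (a :: u)) b.
Proof.
set w := a :: u => uc mb pu ba bl.
have [uw mw] : uniq w /\ {in w, forall x, m x \notin w}.
  by apply: uniq_dblP; case/andP: uc.
have bNw : b \notin dbl w by case/andP: uc.
have EM : cycle_edges (b :: dbl w) :&: M = [set [set x; m x] | x in w].
  apply/setP => E; rewrite inE; apply/andP/imsetP => [[/imsetP[x xc ->]]|].
    rewrite (mem_matching hM) // => /eqP nx; rewrite nx.
    have xw : x \in dbl w.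
      move: xc; rewrite inE => /predU1P[xb|//].
      have: next (b :: dbl w) x \in b :: dbl w by rewrite mem_next xb mem_head.
      by rewrite nx xb inE (negPf mb) (negPf (mate_neq hM b)).
    move: xw; rewrite mem_dbl => /orP[xw|mxw]; first by exists x.
    by exists (m x) => //; rewrite mK setUC.
  case=> x xw ->; rewrite (mate_edge hM) //; split=> //.
  by apply/imsetP; exists x; rewrite ?next_dbl // inE mem_dbl xw orbT.
split; [|split].
- rewrite /is_cycle uc andbT /= ba (adj_mate hM) //= rcons_path path_dbl //=.
  by rewrite last_dbl adj_sym bl.
- exists (size w); rewrite [size _]/= size_dbl; split=> //.
  rewrite EM card_in_imset; first by apply/card_uniqP.
  move=> x y xw yw /setP/(_ x); rewrite !inE eqxx /=.
  case/esym/orP => /eqP // E; by move: (mw y yw); rewrite -E xw.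
- apply/setP => x; rewrite !inE EM.
  have -> : (x \in cover [set [set x; m x] | x in w]) = (x \in dbl w).
    apply/bigcupP/idP => [[_ /imsetP[y yw ->]]|].
      by rewrite in_set2 mem_dbl => /orP[]/eqP ->; rewrite ?mK yw ?orbT.
    rewrite mem_dbl => /orP[xw|xw].
      by exists [set x; m x]; [apply/imsetP; exists x | rewrite !inE eqxx].
    exists [set m x; m (m x)]; first by apply/imsetP; exists (m x).
    by rewrite mK !inE eqxx orbT.
  by case: (altP (x =P b)) => [->|_] /=; rewrite ?bNw ?andNb.
Qed.

(** The chord from [a1] to [s] closes a blossom with base [s] over [a1 :: l], the chord from [m t]
    to the far end closes one with base [m t] over [a2 :: r], and [s :: mid] unfolds to the joining
    path. Uniqueness in [dbl u] makes the blossoms disjoint. *)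
Lemma Tposy_dbl (a1 a2 s t : T) (l mid r : seq T) :
  let u := (a1 :: l) ++ (s :: mid) ++ (a2 :: r) in
  sorted arc u -> uniq (dbl u) -> last s mid = t ->
  adj G a1 s -> adj G (m t) (m (last a2 r)) ->
  {in dbl u, forall v, in_Tposy G M v}.
Proof.
move=> u su uu mt a1s tz v vu.
have := uu; rewrite /u !dbl_cat cat_uniq [uniq (_ ++ dbl (a2 :: r))]cat_uniq has_cat negb_or.
case/and3P=> uL /andP[LM LR] /and3P[uM MR uR].
have notL x : x \in dbl (s :: mid) -> x \notin dbl (a1 :: l).
  by move=> xM; apply: contra LM => xL; apply/hasP; exists x.
have notR x : x \in dbl (s :: mid) -> x \notin dbl (a2 :: r).
  by move=> xM; apply: contra MR => xR; apply/hasP; exists x.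
have RnotL x : x \in dbl (a2 :: r) -> x \notin dbl (a1 :: l).
  by move=> xM; apply: contra LR => xL; apply/hasP; exists x.
have sM : s \in dbl (s :: mid) by rewrite mem_head.
have msM : m s \in dbl (s :: mid) by rewrite mem_dbl mK mem_head orbT.
have tM : t \in dbl (s :: mid) by rewrite mem_dbl -mt mem_last.
have mtM : m t \in dbl (s :: mid) by rewrite mem_dbl mK -mt mem_last orbT.
move: (su); rewrite /= !cat_path /= !cat_path /= mt.
case/and3P=> pl ls /and3P[pm ta2 pr].
exists (s :: dbl (a1 :: l)), s, (m t :: dbl (a2 :: r)), (m t), (m s :: dbl mid).
split; last first.
  move: vu; rewrite /u !dbl_cat mem_cat [v \in dbl (s :: mid) ++ _]mem_cat.
  case/or3P=> [vL|vM|vR]; [left|right; right|right; left] => //.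
    by rewrite in_cons vL orbT.
  by rewrite in_cons vR orbT.
split.
  apply: blossom_dbl => //; last by rewrite adj_sym.
  - by rewrite cons_uniq notL.
  - exact: notL.
  by rewrite adj_sym.
split.
  apply: blossom_dbl => //; first by rewrite cons_uniq notR.
  by rewrite mK notR.
split; first by apply: mm_path_dbl.
split; first by rewrite /= last_dbl mt.
split.
  move=> x xM xs xt; rewrite !in_cons (negPf xs) (negPf xt) /=.
  by split; [apply: notL|apply: notR].
left; apply/setP => x; rewrite in_setI in_set in_set in_set0; apply/negP.
rewrite [x \in s :: _]in_cons [x \in m t :: _]in_cons.
case/andP=> /predU1P[->|xL] /predU1P[E|xR].
- by have := (uniq_dblP uM).2 t; rewrite -mt mem_last mt => /(_ isT); rewrite -E mem_head.
- by move: xR; apply/negP; apply: notR.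
- by move: xL; apply/negP; rewrite E; apply: notL.
by move: xL; apply/negP; apply: RnotL.
Qed.

End AlternatingPaths.


(** * Posies in a mate-closed subgraph of minimum degree two *)

Section MinimumDegreeTwo.
Set Implicit Arguments.
Unset Strict Implicit.
Variables (T : finType) (G : sgraph T) (M : {set {set T}}).
Hypothesis uM : unique_perfect_matching G M.
Implicit Types (u : seq T).
Local Notation m := (mate M).
Local Notation dbl := (unfold_arcs M).
Local Notation arcM := (arc G M).

Let hM : perfect_matching G M := uM.1.
Let mK : involutive m := mateK hM.

(* Exchanging the edges of an alternating cycle would give another perfect
   matching. *)
Lemma no_arc_cycle u : cycle arcM u -> uniq (dbl u) -> size u <= 1.
Proof.
move=> cu udu; have [uu mu] := uniq_dblP hM udu.
(* The matching after the exchange: [x] in [u] is matched to the mate of its predecessor, along the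
   arc entering [x]; vertices off the cycle keep their mates. *)
pose f x := if x \in u then m (prev u x) else
            if m x \in u then next u (m x) else m x.
have fK : involutive f.
  move=> x; rewrite /f; case: (boolP (x \in u)) => [xu|xNu].
    have pu : prev u x \in u by rewrite mem_prev.
    by rewrite (negPf (mu _ pu)) mK pu next_prev.
  case: (boolP (m x \in u)) => [mxu|mxNu]; last by rewrite (negPf mxNu) mK (negPf xNu).
  by rewrite mem_next mxu prev_next // mK.
have fadj x : adj G x (f x).
  rewrite /f; case: ifP => [xu|_]; first by rewrite adj_sym; apply: prev_cycle cu xu.
  case: ifP => [mxu|_]; last exact: adj_mate hM x.
  by have := next_cycle cu mxu; rewrite /arc mK.
have fm := unique_mate uM fK fadj.
(* Agreement of [f] with the mate at [b] forces the predecessor of [b], which is [a], to be [b]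
   itself. *)
case: u => [|a [|b u]] // in cu udu uu mu f fK fadj fm *.
have := fm b; rewrite /f !inE eqxx orbT => /(can_inj mK).
have -> : prev [:: a, b & u] b = a.
  have ab : a != b by case/andP: uu; rewrite inE negb_or => /andP[].
  by rewrite -[b in prev _ b](_ : next [:: a, b & u] a = b) ?prev_next //= eqxx.
by move=> E; move: uu; rewrite E /= inE eqxx.
Qed.

(** An arc from the end of a segment back to its start closes a cycle. The one-entry case survives
    because the matching edge itself gives [arcM a a]. *)
Lemma no_arc_cycle_infix p a c q :
  sorted arcM (p ++ (a :: c) ++ q) -> uniq (dbl (p ++ (a :: c) ++ q)) ->
  arcM (last a c) a -> c = [::].
Proof.
move=> /cat_sorted2[_ /cat_sorted2[sc _]] + ca.
rewrite !dbl_cat cat_uniq => /and3P[_ _]; rewrite cat_uniq => /and3P[uc _ _].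
have : size (a :: c) <= 1 by apply: no_arc_cycle uc; rewrite /= rcons_path ca andbT.
by case: c {ca sc uc}.
Qed.

Lemma dbl_rev_mate u : dbl (rev (map m u)) = rev (dbl u).
Proof.
elim: u => //= a u IH.
rewrite rev_cons -cats1 dbl_cat IH -[dbl [:: m a]]/[:: m a; m (m a)] mK.
by rewrite -[dbl (a :: u)]/[:: a, m a & dbl u] !rev_cons -!cats1 -catA.
Qed.

Variable H : {set T}.
Hypothesis mateH : {in H, forall x, m x \in H}.
Hypothesis degH : {in H, forall x, 2 <= degree_in G H x}.

Lemma second_neighbour x y : x \in H ->
  exists2 w, w \in H & adj G x w && (w != y).
Proof.
move=> /degH; rewrite /degree_in (cardsD1 y) => d2.
have: 0 < #|[set w in H | adj G x w] :\ y|.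
  by case: (y \in _) d2 => //; apply: leq_trans.
by case/card_gt0P=> w; rewrite !inE => /and3P[wy wH xw]; exists w; rewrite ?xw.
Qed.

Lemma dbl_extend w u : w \notin dbl u -> uniq (dbl u) -> uniq (dbl (w :: u)).
Proof.
rewrite /= inE (mem_dbl hM) (mem_dbl hM) mK [w == m w]eq_sym (negPf (mate_neq hM _)) /= !negb_or.
by move=> /andP[-> ->].
Qed.

Lemma sorted_arc_max_Tposy u v : sorted arcM u -> uniq (dbl u) ->
  {subset u <= H} -> u != [::] ->
  (forall w, w \in H -> adj G (head v u) w -> w \in dbl u) ->
  (forall w, w \in H -> adj G (m (last v u)) w -> w \in dbl u) ->
  {in dbl u, forall v, in_Tposy G M v}.
Proof.
case: u => // y u su udu uH _ maxl maxr.
have zH : last y u \in H by rewrite uH // mem_last.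
(* The chord ends: [w] is a neighbour of the last vertex [m (last y u)] other than its mate, and [x]
   plays the same role for the first vertex [y]. *)
have [w wH /andP[zw wz]] := second_neighbour (last y u) (mateH zH).
have [x xH /andP[yx xy]] := second_neighbour (m y) (uH _ (mem_head y u)).
have {}maxr := maxr _ wH zw; have {}maxl := maxl _ xH yx.
(* Parity of [w]: if [w] were an entry, the chord would be an arc from the last entry back to
   [w]. *)
have mwu : m w \in y :: u.
  move: maxr; rewrite (mem_dbl hM) => /orP[/splitPr wu|//]; exfalso.
  case: {-1}_ / wu (erefl (y :: u)) => p q E.
  have zE : last y u = last w q.
    by rewrite -[last y u]/(last y (y :: u)) E last_cat.
  move: (su) (udu); rewrite E -[w :: q]cats0 => s1 u1.
  move: zw; rewrite zE => /(no_arc_cycle_infix s1 u1) q0.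
  by rewrite zE q0 eqxx in wz.
(* Parity of [x]: if [m x] were an entry, the chord would be an arc from [m x] back to [y]. *)
have xu : x \in y :: u.
  move: maxl; rewrite (mem_dbl hM) => /orP[//|/splitPr mxu]; exfalso.
  case: {-1}_ / mxu (erefl (y :: u)) => p q E.
  move: (su) (udu); rewrite E -cat_rcons => s1 u1.
  case: p => [|y' p] in E s1 u1; first by case: E xy => ->; rewrite mK eqxx.
  case: E => yy' _; subst y'.
  have := @no_arc_cycle_infix [::] y (rcons p (m x)) q s1 u1.
  by rewrite last_rcons /arc mK adj_sym => /(_ yx); case: p {s1 u1}.
case/splitPr: {-1}_ / mwu (erefl (y :: u)) => r1 r2 E.
case: r2 => [|a2 r] in E *.
  have zE : last y u = m w by rewrite -[last y u]/(last y (y :: u)) E last_cat.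
  by rewrite zE mK adj_irrefl in zw.
have zE : last y u = last a2 r.
  by rewrite -[last y u]/(last y (y :: u)) E last_cat.
rewrite -cat_rcons in E.
have arc_wz : arcM (m w) (m (last a2 r)) by rewrite /arc mK adj_sym -zE.
(* If [x] comes no later than [m w], cutting before [x] and after [m w] gives the three segments of
   a posy. *)
move: (su) (udu) (xu) => /[!E] s1 u1; rewrite mem_cat => /orP[] xr.
  case/splitPr: {-1}_ / xr (erefl (rcons r1 (m w))) => l mid El.
  rewrite El -catA in E s1 u1 *.
  have wE : last x mid = m w by rewrite -[LHS](last_cat y l (x :: mid)) -El last_rcons.
  case: l => [|y' l] in E El s1 u1 *; first by case: E yx => ->; rewrite adj_irrefl.
  case: E => yy' _; subst y'.
  by have := Tposy_dbl hM s1 u1 wE yx arc_wz; rewrite catA -El cat_rcons.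
case/splitPr: {-1}_ / xr (erefl (a2 :: r)) => q l2 Eq; exfalso.
have lE : last a2 r = last x l2.
  by rewrite -[last a2 r]/(last a2 (a2 :: r)) Eq last_cat.
rewrite {}Eq in E s1 u1.
have [c Ec] : exists c, rcons r1 (m w) = y :: c.
  by case: r1 E {s1 u1} => [|y' r1] /= [<- _]; eexists.
have wE : last y c = m w by rewrite -[LHS]/(last y (y :: c)) -Ec last_rcons.
rewrite Ec in s1 u1.
(* The forbidden cycle goes from [y] to [m w] and on to [w], takes the chord to the far end, runs
   backwards to [x] and returns by the chord to [y]; the part [q] is skipped. *)
have: size ((y :: c) ++ rev (map m (x :: l2))) <= 1.
  apply: no_arc_cycle; last first.
    rewrite dbl_cat dbl_rev_mate // (perm_uniq (_ : perm_eq _ (dbl (y :: c) ++ dbl (x :: l2)))).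
      by apply: subseq_uniq u1; rewrite !dbl_cat cat_subseq // suffix_subseq.
    by rewrite perm_cat2l perm_rev.
  have [/= sc /cat_sorted2[_ /= sl]] := cat_sorted2 s1.
  rewrite /= rcons_cat cat_path sc rcons_path wE andTb; apply/andP; split; last first.
    by rewrite rev_cons last_rcons /arc mK adj_sym.
  rewrite lastI rev_rcons /= rev_path last_map -lE arc_wz path_map /=.
  by rewrite (eq_path (e' := arcM)) // => a b /=; rewrite arc_mate.
by rewrite size_cat size_rev /= addnS.
Qed.

Lemma minimum_degree_two_Tposy : {in H, forall v, in_Tposy G M v}.
Proof.
move=> v vH.
(* The path grows at either end while it can; [n] bounds the number of entries that can still be
   added. *)
suff ext n u : #|T| <= size u + n -> sorted arcM u -> uniq (dbl u) ->
    {subset u <= H} -> v \in dbl u -> in_Tposy G M v.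
  apply: (ext #|T| [:: v]); rewrite ?leq_addl //= ?mem_head //.
    by rewrite andbT inE eq_sym (mate_neq hM).
  by move=> x; rewrite inE => /eqP ->.
elim: n u => [|n IH] u lt_u su udu uH vu.
  (* The path has twice as many vertices as entries, so a nonempty [u] cannot have [#|T|]
     entries. *)
  have := max_card (mem (dbl u)); rewrite (card_uniqP udu) size_dbl => le_u.
  case: u vu {su udu uH} lt_u le_u => //= a u _; rewrite addn0 => Tu uT.
  by have := leq_trans uT Tu; rewrite -addnn -[leqRHS]addn0 leq_add2l.
have uN0 : u != [::] by apply: contraTneq vu => ->.
have uE : u = head v u :: behead u by case: u uN0 {IH lt_u su udu uH vu}.
have [/forall_inP maxl|] :=
  boolP [forall (w | (w \in H) && adj G (head v u) w), w \in dbl u]; last first.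
  (* The new entry is [m w], since an arc uses an edge at the mate of its tail. *)
  case/forall_inPn=> w /andP[wH uw] wNu; apply: (IH (m w :: u)).
  - by rewrite /= addSnnS.
  - by rewrite uE /= /arc mK adj_sym uw /=; move: su; rewrite {1}uE.
  - by apply: dbl_extend udu; apply: contra wNu; rewrite !(mem_dbl hM) mK orbC.
  - by move=> x; rewrite inE => /predU1P[->|/uH //]; apply: mateH.
  - by rewrite -cat1s dbl_cat mem_cat vu orbT.
have [/forall_inP maxr|] :=
  boolP [forall (w | (w \in H) && adj G (m (last v u)) w), w \in dbl u]; last first.
  case/forall_inPn=> w /andP[wH uw] wNu; apply: (IH (rcons u w)).
  - by rewrite size_rcons addSnnS.
  - by move: su uw; rewrite uE /= rcons_path => -> /=.
  - rewrite -cats1 dbl_cat (perm_uniq (permEl (perm_catC _ _))).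
    exact: dbl_extend wNu udu.
  - by move=> x; rewrite mem_rcons inE => /predU1P[->|/uH].
  - by rewrite -cats1 dbl_cat mem_cat vu.
apply: (sorted_arc_max_Tposy (v := v) su udu uH uN0) vu => w wH vw.
  by apply: maxl; rewrite wH.
by apply: maxr; rewrite wH.
Qed.

End MinimumDegreeTwo.

(** * Mates and neighbours of the vertices of a posy *)

Section TposyVertices.
Set Implicit Arguments.
Unset Strict Implicit.
Variables (T : finType) (G : sgraph T) (M : {set {set T}}).
Hypothesis hM : perfect_matching G M.
Implicit Types (c p : seq T) (b x y : T).
Local Notation m := (mate M).

Lemma mate_eq x y : [set x; y] \in M -> m x = y.
Proof. by rewrite (mem_matching hM) => /eqP. Qed.

Lemma next_neq_prev c x : uniq c -> 2 < size c -> x \in c ->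
  next c x != prev c x.
Proof.
move=> uc sc /rot_to[i c' E]; apply/eqP => e.
have: next c (next c x) = x by rewrite e next_prev.
have uc' := uc; rewrite -(rot_uniq i) E in uc'.
rewrite -[next c x](next_rot i uc) -(next_rot i uc) E.
move: sc; rewrite -(size_rot i) E {E e}.
case: c' uc' => [|y [|z s]] //= /and3P[xN _ _] _; rewrite eqxx.
move: xN; rewrite !inE !negb_or => /and3P[xy xz _].
by rewrite eq_sym (negPf xy) eqxx => /esym/eqP; rewrite (negPf xz).
Qed.

Lemma blossom_neighbours c b x : blossom G M c b -> x \in c ->
  exists y z, [/\ y \in c, z \in c, y != z, adj G x y & adj G x z].
Proof.
case=> /and3P[cc uc sc] _ xc; exists (next c x), (prev c x).
rewrite mem_next mem_prev next_neq_prev //; split=> //; first exact: next_cycle.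
by rewrite adj_sym; apply: prev_cycle.
Qed.

Lemma blossom_base c b : blossom G M c b -> b \in c.
Proof. by case=> _ [_ /setP/(_ b)]; rewrite !inE eqxx => /andP[]. Qed.

Lemma blossom_mate c b x : blossom G M c b -> x \in c -> x != b -> m x \in c.
Proof.
case=> _ [_ /setP/(_ x)]; rewrite !inE => + xc xb.
rewrite xc (negPf xb) andbT => /negbFE/bigcupP[E].
rewrite inE => /andP[/imsetP[y yc ->] yM].
rewrite !inE => /orP[]/eqP ->; first by rewrite (mate_eq yM) mem_next.
by rewrite (@mate_eq _ y) // setUC.
Qed.

(** Alternation puts one of the two edges at an inner vertex into [M], and the last edge serves the
    end. The first vertex is left out so that the induction reaches tails whose first edge is
    unmatched. *)
Lemma alternating_mate x p y : alternating M x p ->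
  last set0 (path_edges x p) \in M -> y \in p -> m y \in x :: p.
Proof.
elim: p x => [|z p IH] // x; rewrite in_cons => + + /predU1P[->|yp].
  case: p {IH} => [|t p] alt lst.
    by rewrite (@mate_eq _ x) ?mem_head // setUC.
  have /= /andP[+ _] := alt.
  have [xzM _|_ /= ztM] := boolP ([set x; z] \in M).
    by rewrite (@mate_eq _ x) ?mem_head // setUC.
  by rewrite (mate_eq ztM) !in_cons eqxx !orbT.
case: p IH yp => [|t p] IH yp //= alt lst.
rewrite in_cons; apply/orP; right; apply: IH yp => //.
by case/andP: alt.
Qed.

Lemma mm_path_mate x p y : mm_path G M x p -> y \in x :: p -> m y \in x :: p.
Proof.
case/and4P=> /andP[_ alt] + hd lst; rewrite in_cons => p0 /predU1P[->|]; last first.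
  exact: alternating_mate.
by case: p {alt lst} p0 hd => // z p _ /mate_eq ->; rewrite !inE eqxx orbT.
Qed.

Lemma path_inner_neighbours x p y : is_path G x p -> y \in x :: p ->
  y != x -> y != last x p ->
  exists a b, [/\ a \in x :: p, b \in x :: p, a != b, adj G y a & adj G y b].
Proof.
move=> /andP[pp up]; rewrite in_cons => /predU1P[->|]; first by rewrite eqxx.
move=> yp _; case/splitPr: yp pp up => p1 [|b p2] + up.
  by rewrite last_cat /= eqxx.
rewrite cat_path => /= /and4P[_ ly yb _] _.
exists (last x p1), b; split=> //.
- by rewrite -[x :: _]/((x :: p1) ++ _) mem_cat mem_last.
- by rewrite -[x :: _]/((x :: p1) ++ _) mem_cat !inE eqxx !orbT.
- move: up; rewrite -cat_cons [x :: p1]lastI cat_rcons cat_uniq.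
  by case/and3P=> _ _ /andP[+ _]; rewrite !inE !negb_or => /and3P[].
by rewrite adj_sym.
Qed.

(** A blossom contains the mates of its vertices other than the base; the bases are the ends of the
    joining path, which is closed under mates. *)
Lemma in_Tposy_mate v : in_Tposy G M v -> in_Tposy G M (m v).
Proof.
case=> c1 [b1 [c2 [b2 [p [P vP]]]]]; exists c1, b1, c2, b2, p; split=> //.
have [B1 [B2 [pp [lp _]]]] := P.
have pV x : x \in b1 :: p -> m x \in c1 \/ m x \in c2 \/ m x \in b1 :: p.
  by right; right; apply: mm_path_mate.
case: vP => [vc|[vc|/pV //]].
  have [->|vb] := eqVneq v b1; first by apply: pV; rewrite mem_head.
  by left; apply: blossom_mate vb.
have [->|vb] := eqVneq v b2; first by apply: pV; rewrite -lp mem_last.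
by right; left; apply: blossom_mate vb.
Qed.

(** Blossom vertices, bases included, have two neighbours on their cycle; any other vertex is
    interior to the joining path. *)
Lemma in_Tposy_neighbours v : in_Tposy G M v -> exists y z,
  [/\ in_Tposy G M y, in_Tposy G M z, y != z, adj G v y & adj G v z].
Proof.
case=> c1 [b1 [c2 [b2 [p [P vP]]]]].
have [B1 [B2 [/andP[/andP[pp _] _] [lp _]]]] := P.
suff [y [z [yP zP yz vy vz]]] : exists y z,
    [/\ y \in c1 \/ y \in c2 \/ y \in b1 :: p,
        z \in c1 \/ z \in c2 \/ z \in b1 :: p, y != z, adj G v y & adj G v z].
  by exists y, z; split=> //; exists c1, b1, c2, b2, p.
have C1 : v \in c1 -> exists y z,
    [/\ y \in c1 \/ y \in c2 \/ y \in b1 :: p,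
        z \in c1 \/ z \in c2 \/ z \in b1 :: p, y != z, adj G v y & adj G v z].
  by case/(blossom_neighbours B1)=> y [z [? ? ? ? ?]]; exists y, z; split; auto.
have C2 : v \in c2 -> exists y z,
    [/\ y \in c1 \/ y \in c2 \/ y \in b1 :: p,
        z \in c1 \/ z \in c2 \/ z \in b1 :: p, y != z, adj G v y & adj G v z].
  by case/(blossom_neighbours B2)=> y [z [? ? ? ? ?]]; exists y, z; split; auto.
case: vP => [/C1 //|[/C2 //|vp]].
have [vb|vb1] := eqVneq v b1; first by apply: C1; rewrite vb (blossom_base B1).
have [vb|vb2] := eqVneq v b2; first by apply: C2; rewrite vb (blossom_base B2).
rewrite -lp in vb2.
by have [y [z [? ? ? ? ?]]] := path_inner_neighbours pp vp vb1 vb2; exists y, z; split; auto.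
Qed.

End TposyVertices.

(** * Termination and an invariant of the procedure *)

Section Procedure.
Set Implicit Arguments.
Unset Strict Implicit.
Variables (T : finType) (G : sgraph T) (M : {set {set T}}).

Lemma step_terminates s : Acc (fun s' s => step G M s s') s.
Proof.
have [n] := ubnP #|s.2|; elim: n s => [|n IH] s sn.
  by exfalso; rewrite ltn0 in sn.
constructor=> s' st.
case: st sn => K H v vH _ /= Hn; apply: IH => /=.
rewrite -ltnS; apply: leq_trans Hn; rewrite ltnS (cardsD1 v H) vH.
exact/subset_leq_card/subsetDl.
Qed.

Hypothesis hM : perfect_matching G M.
Local Notation m := (mate M).
Let mK : involutive m := mateK hM.

Variable S : {set T}.
Hypothesis mateS : {in S, forall x, m x \in S}.
Hypothesis degS : {in S, forall x, 2 <= degree_in G S x}.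

(** To be applied with [SD G] for [S]; the last clause says that no vertex of [S] has been
    deleted. *)
Definition procedure_invariant (s : {set T} * {set T}) : Prop :=
  [/\ s.1 = ~: s.2, {in s.2, forall x, m x \in s.2} & S \subset s.2].

Lemma initial_invariant : procedure_invariant (initial_state T).
Proof. by split=> //=; rewrite ?setCT ?subsetT // => x; rewrite inE. Qed.

Lemma step_invariant s s' : step G M s s' ->
  procedure_invariant s -> procedure_invariant s'.
Proof.
case=> K H v vH d1 [/= KE mH SH]; split=> /=.
- by apply/setP => x; rewrite KE !inE !negb_and !negbK orbC orbA [(x == m v) || _]orbC.
- move=> x; rewrite !inE => /and3P[xmv xv xH].
  by rewrite (inj_eq (can_inj mK)) xv mH // (can2_eq mK mK) xmv.
(* A vertex of [S] has degree at least 2 in [S], hence also in [H]. *)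
have vS : v \notin S.
  apply: contraTN isT => /degS; rewrite leqNgt ltnS -d1 => /negP[].
  apply/subset_leq_card/subsetP => x; rewrite !inE => /andP[xS ->].
  by rewrite (subsetP SH).
have mvS : m v \notin S by apply: contra vS => /mateS; rewrite mK.
by rewrite !subsetD1 SH vS mvS.
Qed.

Lemma reachable_invariant s : clos_refl_trans _ (step G M) (initial_state T) s ->
  procedure_invariant s.
Proof.
move=> st; elim: st initial_invariant => {s} [s s'|//|s s' s'' _ IH _ IH' /IH/IH' //].
exact: step_invariant.
Qed.

End Procedure.

Theorem mainTheorem2 (T : finType) (G : sgraph T) (M : {set {set T}})
  (hM : perfect_matching G M)
  (hunique : forall M' : {set {set T}}, perfect_matching G M' -> M' = M) :
  always_terminates G M /\
  forall out : {set T} * {set T}, is_output G M out -> out = (SD G, KE G).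
Proof.
split=> [|out [K [H [reach [stop ->]]]]]; first exact: step_terminates.
have SD_Tposy v : v \in SD G <-> in_Tposy G M v.
  rewrite inE; split=> [/asboolP[M' [max [[c [b [p [fl _]]]]|]]]|pos].
  (* A stem ends at an unsaturated vertex, and a perfect matching leaves none. *)
  - case: fl => _ [_ [_ [+ _]]].
    by rewrite (proj1 (perfect_matching_maximum _ hM) max).2 inE.
  - by rewrite -(hunique M' (proj1 (perfect_matching_maximum _ hM) max)).
  by apply/asboolP; exists M; split; [apply/(perfect_matching_maximum _ hM)|right].
have mateSD : {in SD G, forall x, mate M x \in SD G}.
  by move=> x /SD_Tposy/(in_Tposy_mate hM)/SD_Tposy.
have degSD : {in SD G, forall x, 2 <= degree_in G (SD G) x}.
  move=> x /SD_Tposy/in_Tposy_neighbours[y [z [/SD_Tposy yS /SD_Tposy zS yz xy xz]]].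
  have <- : #|[set y; z]| = 2 by rewrite cards2 yz.
  apply/subset_leq_card/subsetP => w; rewrite in_set2 [w \in finset _]in_set.
  by case/orP=> /eqP ->; apply/andP.
have [/= -> mateH SDH] := reachable_invariant hM mateSD degSD reach.
have HSD : H \subset SD G.
  apply/subsetP => v vH; apply/SD_Tposy.
  apply: (minimum_degree_two_Tposy (conj hM hunique) mateH) vH => x xH.
  (* The degree in the final [H] is not 1, and it is not 0 because the mate of [x] is in [H]. *)
  have := stop x xH.
  have : 0 < degree_in G H x.
    by apply/card_gt0P; exists (mate M x); rewrite inE mateH // (adj_mate hM).
  by case: (degree_in G H x) => [|[|]].
have -> : H = SD G by apply/eqP; rewrite eqEsubset HSD.
by rewrite setCK.
Qed.
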